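(* If $C$ is a sparse Cantor subset of $\mathbb R$, then the group $\mathfrak{diff}^1(C)$ is countable. If $C$ is a sparse Cantor set in $S^1=\mathbb R/\mathbb Z$, then $\mathfrak{diff}^1_{S^1}(C)$ is countable.
   Context: A Cantor set is a (nonempty) compact totally disconnected set without isolated points. A Cantor subset $C$ of an interval of $\mathbb R$ is $\sigma$-sparse if for any $a<b$ in $C$ there is a complementary interval $(\alpha,\beta)\subset (a,b)\cap (\mathbb R\setminus C)$ such that $\beta-\alpha\geq \sigma(b-a)$; it is sparse if it is $\sigma$-sparse for some $\sigma>0$. A Cantor set $C\subset S^1=\mathbb R/\mathbb Z$ is sparse if, cutting the circle at a point not in $C$ and identifying the complement of this point with an open interval of length $1$, it becomes a sparse Cantor subset of that interval (this does not depend on the cut point). For a manifold $M$ and a Cantor set $C\subset M$, $\mathrm{Diff}^1(M,C)$ is the group of $\mathcal C^1$-diffeomorphisms of $M$ sending $C$ to itself, and $\mathfrak{diff}^1_M(C)$ is the group of transformations of $C$ that arise as restrictions to $C$ of elements of $\mathrm{Diff}^1(M,C)$. One writes $\mathfrak{diff}^1(C)=\mathfrak{diff}^1_{\mathbb R}(C)$. *)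

(* Defs.v *)
From HB Require Import structures.
From mathcomp Require Import all_boot all_order all_algebra.
From mathcomp Require Import all_classical all_reals all_analysis.
From mathcomp Require Import lra zify.
Import Order.TTheory GRing.Theory Num.Theory.
Import numFieldNormedType.Exports.

Set Implicit Arguments.
Unset Strict Implicit.
Unset Printing Implicit Defensive.

Local Open Scope classical_set_scope.
Local Open Scope ring_scope.
Local Open Scope quotient_scope.

Definition cantor_set (T : topologicalType) (C : set T) : Prop :=
  [/\ C !=set0, compact C, totally_disconnected C & isolated C = set0].

Definition complementary (R : realType) (C I : set R) : Prop :=
  exists2 x, ~ C x & I = connected_component (~` C) x.

Definition sigma_sparse (R : realType) (sigma : R) (C : set R) : Prop :=
  forall a b : R, C a -> C b -> a < b ->
  exists alpha beta : R,
    [/\ complementary C `]alpha, beta[,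
        `]alpha, beta[ `<=` `]a, b[ `&` ~` C &
        sigma * (b - a) <= beta - alpha].

Definition sparse (R : realType) (C : set R) : Prop :=
  exists2 sigma : R, 0 < sigma & sigma_sparse sigma C.

(* In both uses of these two definitions, D is the set of all C^1 self-maps
   of the manifold M, and restrictions D C is the group of transformations of
   C induced by the C^1-diffeomorphisms f of M with f(C) = C. *)
Definition diffeos (M : Type) (D : set (M -> M)) : set (M -> M) :=
  [set f | D f /\ exists g, [/\ D g, cancel f g & cancel g f]].

Definition restrictions (M : Type) (D : set (M -> M)) (C : set M) :
    set (C -> C) :=
  [set g | exists f, [/\ diffeos D f, f @` C = C &
                         forall x : C, val (g x) = f (val x)]].

Arguments restrictions {M} D C.

(* Meaningful for open U only, since derive1 f is a two-sided derivative. *)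
Definition C1_on (R : realType) (U : set R) (f : R -> R) : Prop :=
  (forall x, U x -> derivable f x 1) /\ {within U, continuous (derive1 f)}.

Definition line_C1 (R : realType) : set (R -> R) := [set f | C1_on setT f].

(* R / Z, with the quotient topology. *)
Definition circle (R : realType) :=
  quotient_topology
    (Quotient.quot (GRing.ZmodClosed.clone R (@Num.int_num_subdef R) _)).
HB.instance Definition _ (R : realType) := Topological.on (circle R).

Definition circle_pi (R : realType) (t : R) : circle R := \pi_(circle R) t.

(* The representative in [a, a + 1[ of a point of the circle. Away from
   circle_pi a, this is the identification of the circle cut at circle_pi a
   with the open interval ]a, a + 1[; these maps are the charts of the circle. *)
Definition chart (R : realType) (a : R) (p : circle R) : R :=
  repr p - (Num.floor (repr p - a))%:~R.

Lemma circle_piP (R : realType) (s t : R) :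
  circle_pi s = circle_pi t <-> s - t \is a Num.int.
Proof.
pose I := GRing.ZmodClosed.clone R (@Num.int_num_subdef R) _.
have E : (s - t \is a Num.int) = (s == t %[mod {ideal_quot I}]).
  exact: (@Quotient.idealrBE R I).
rewrite E; split=> [st|/eqP //]; exact/eqP.
Qed.

Lemma chartK (R : realType) (a : R) (p : circle R) :
  circle_pi (chart a p) = p.
Proof.
rewrite -[RHS](reprK p) -[RHS]/(circle_pi (repr p)); apply/circle_piP.
by rewrite /chart addrAC subrr add0r rpredN intr_int.
Qed.

Lemma chart_itv (R : realType) (a : R) (p : circle R) : a <= chart a p < a + 1.
Proof.
have := Num.Theory.floor_itv (repr p - a).
rewrite /chart intrD => /andP[h1 h2]; apply/andP; split; lra.
Qed.

Lemma circle_piK (R : realType) (a t : R) :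
  a <= t < a + 1 -> chart a (circle_pi t) = t.
Proof.
move=> /andP[at1 ta1]; have /andP[ac ca1] := chart_itv a (circle_pi t).
have /circle_piP/intrP[n nE] := chartK a (circle_pi t).
suff n0 : n = 0 by apply/eqP; rewrite -subr_eq0 nE n0.
have h1 : n%:~R < (1%:~R : R) by rewrite -nE; lra.
have h2 : (-1)%:~R < (n%:~R : R) by rewrite -nE rmorphN1; lra.
by move: h1 h2; rewrite !ltr_int; lia.
Qed.

(* f is C^1 when it is continuous and all its expressions in the charts
   are C^1 on the (open) sets where they are defined. *)
Definition circle_C1 (R : realType) : set (circle R -> circle R) :=
  [set f | continuous f /\
    forall a b : R,
      C1_on [set t | a < t < a + 1 /\ f (circle_pi t) <> circle_pi b]
            (chart b \o f \o @circle_pi R)].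

Definition circle_sparse (R : realType) (C : set (circle R)) : Prop :=
  exists2 a : R, ~ C (circle_pi a) & sparse (chart a @` C).

(* Main.v *)
Require Import Defs.
From mathcomp Require Import all_boot all_order all_algebra.
From mathcomp Require Import all_classical all_reals all_analysis.
From mathcomp Require Import lra.
Import Order.TTheory GRing.Theory Num.Theory.
Import numFieldNormedType.Exports.

Set Implicit Arguments.
Unset Strict Implicit.
Unset Printing Implicit Defensive.

Local Open Scope classical_set_scope.
Local Open Scope ring_scope.

(** The theorem follows from a rigidity statement: two diffeomorphisms that are
close enough in the C^1 topology have the same restriction to a sparse compact
set K. As the space of continuous functions on a segment is separable, this
leaves room for only countably many restrictions.

Rigidity ([eq_on_sparse]). Let K be sigma-sparse with extremes c and d, and let
f, g be C^1 on [c, d], with derivatives at least m > 0, with |f' - g'| at most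
sigma m, and with f(K) = g(K). Both are increasing, so f(c) = g(c) is the least
point of f(K) and f(d) = g(d) the greatest. If f and g differ at some x in K,
let p < x < q be the points of K nearest to x where they agree. Sparsity gives
a gap (alpha, beta) of K inside (p, q) of length at least sigma (q - p). Its
images under f and under g are gaps of the same set f(K), so they are equal or
disjoint. Equal images would mean that f and g agree at alpha and beta, hence
alpha = p and beta = q, and x would lie in the gap. If they are disjoint, then
|f - g| at alpha is at least the length of one of the images, hence at least
m sigma (q - p); but f - g vanishes at p and has slope at most sigma m, so at
alpha it is smaller than sigma m (q - p).

Countability. A function f is encoded by the sign of f', a rational q with
0 < q <= |f'| on [c, d], and a finite family of rational rectangles covering the
graph of f' with precision sigma q / 2 ([encodes]). Two functions with the same
code and the same image of K satisfy the hypotheses of rigidity, up to a common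
sign, so they coincide on K ([encodes_inj]).

On the line this applies to the diffeomorphism itself. On the circle, C is cut
at a point a outside C and becomes a compact K in a segment [c, d] of length
less than 1. The arc [c, d] omits an open set of the circle, and so does its
image under f; a rational point b of that open set serves to cut the target
circle ([rational_cut]). In the charts at a and b, f is then a C^1 function
on [c, d]: the two cuts play the role of a lift to the universal cover. Adding b
to the code finishes the proof. *)

(** * Gaps of a set of reals *)

(** An end of the interval outside C could be added to it without losing
connectedness, against the maximality of a component. *)
Lemma complementary_itvoo (R : realType) (C : set R) (alpha beta : R) :
  complementary C `]alpha, beta[ ->
  [/\ alpha < beta, C alpha, C beta & forall x, alpha < x < beta -> ~ C x].
Proof.
move=> [x nCx Ex].
have : `]alpha, beta[%classic x by rewrite Ex; exact: connected_component_refl.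
rewrite /= in_itv/= => /andP[ax xb].
have gap y : alpha < y < beta -> ~ C y.
  move=> yI; apply: (@connected_component_sub _ (~` C) x).
  by rewrite -Ex /= in_itv.
have max (i : interval R) : x \in i -> [set` i] `<=` ~` C ->
    [set` i] `<=` `]alpha, beta[.
  move=> xi iC; rewrite Ex; apply: connected_component_max => //.
  by apply/connected_intervalP; exact: interval_is_interval.
split=> //; first exact: lt_trans xb.
- apply: contrapT => nCa.
  suff /(_ alpha) : `[alpha, beta[ `<=` `]alpha, beta[.
    by rewrite /= !in_itv/= lexx ltxx (lt_trans ax xb) => /(_ isT).
  apply: max; first by rewrite in_itv/= ltW.
  move=> y; rewrite /= in_itv/= le_eqVlt => /andP[/predU1P[<-//|ay] yb].
  by apply: gap; rewrite ay.
- apply: contrapT => nCb.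
  suff /(_ beta) : `]alpha, beta] `<=` `]alpha, beta[.
    by rewrite /= !in_itv/= lexx ltxx andbF (lt_trans ax xb) => /(_ isT).
  apply: max; first by rewrite in_itv/= ax ltW.
  move=> y; rewrite /= in_itv/= le_eqVlt => /andP[ay /predU1P[->//|yb]].
  by apply: gap; rewrite ay.
Qed.

(** * Rigidity of functions with close derivatives *)

Lemma compact_agreement (R : realType) (K : set R) (f g : R -> R) :
  compact K -> {in K, continuous f} -> {in K, continuous g} ->
  compact (K `&` [set x | f x = g x]).
Proof.
move=> cK cf cg; apply: (@subclosed_compact _ _ K) => //.
have clK : closed K by apply: compact_closed => //; exact: Rhausdorff.
move=> x clx.
have Kx : K x by apply: clK; apply: closureS clx; exact: subIsetl.
split=> //=; apply: contrapT => /eqP; rewrite -subr_eq0 => fgx.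
have fgcvg : (fun y => f y - g y) @ x --> f x - g x.
  by apply: cvgB; [apply: cf|apply: cg]; rewrite inE.
have /clx[y [[_ /= fgy] /=]] : nbhs x [set y | f y - g y != 0].
  by apply: (fgcvg [set z | z != 0]); apply: open_nbhs_nbhs; split=> //;
    exact: open_neq.
by rewrite fgy subrr eqxx.
Qed.

Lemma compact_has_max (R : realType) (K : set R) :
  compact K -> K !=set0 -> exists2 c, K c & forall x, K x -> x <= c.
Proof.
move=> cK K0.
have [|c Kc cmax] := @compact_EVT_max _ R id K K0 cK.
  by apply: continuous_subspaceT => ?; exact: cvg_id.
by exists c => [|x Kx]; [rewrite inE in Kc|apply: cmax; rewrite inE].
Qed.

Lemma compact_has_min (R : realType) (K : set R) :
  compact K -> K !=set0 -> exists2 c, K c & forall x, K x -> c <= x.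
Proof.
move=> cK K0.
have [|c Kc cmax] := @compact_EVT_min _ R id K K0 cK.
  by apply: continuous_subspaceT => ?; exact: cvg_id.
by exists c => [|x Kx]; [rewrite inE in Kc|apply: cmax; rewrite inE].
Qed.

Lemma itvoo_subset (R : realType) (a b p q : R) :
  a < b -> `]a, b[ `<=` `]p, q[ -> p <= a /\ b <= q.
Proof.
move=> ab sub.
have {}sub z : a < z -> z < b -> p < z < q.
  by move=> az zb; have := sub z; rewrite /= !in_itv/= az zb; exact.
split; rewrite leNgt; apply/negP => h.
  have [pb|pb] := leP p b.
    by have /andP[] := @sub ((a + p) / 2) ltac:(lra) ltac:(lra); lra.
  by have /andP[] := @sub ((a + b) / 2) ltac:(lra) ltac:(lra); lra.
have [aq|aq] := leP a q.
  by have /andP[] := @sub ((q + b) / 2) ltac:(lra) ltac:(lra); lra.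
by have /andP[] := @sub ((a + b) / 2) ltac:(lra) ltac:(lra); lra.
Qed.

Lemma derive1_le_increment (R : realType) (f : R -> R) (x y M : R) : x <= y ->
  (forall z, x <= z <= y -> derivable f z 1 /\ derive1 f z <= M) ->
  f y - f x <= M * (y - x).
Proof.
move=> xy df.
have [z||z zI ->] := @MVT_segment R f (derive1 f) x y xy.
- rewrite in_itv/= => /andP[xz zy].
  by rewrite derive1E; apply/derivableP; apply: (df _ _).1; rewrite !ltW.
- apply: derivable_within_continuous => z; rewrite in_itv/= => zI.
  exact: (df _ zI).1.
- rewrite ler_wpM2r ?subr_ge0//; apply: (df _ _).2.
  by move: zI; rewrite in_itv.
Qed.

Lemma derive1_ge_increment (R : realType) (f : R -> R) (x y m : R) : x <= y ->
  (forall z, x <= z <= y -> derivable f z 1 /\ m <= derive1 f z) ->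
  m * (y - x) <= f y - f x.
Proof.
move=> xy df.
have : (- f) y - (- f) x <= (- m) * (y - x).
  apply: derive1_le_increment => // z /df[dfz mf]; split.
    exact: derivableN.
  by rewrite derive1E deriveN// -derive1E lerN2.
rewrite mulNr -[(- f) y]/(- f y) -[(- f) x]/(- f x); lra.
Qed.

Lemma derive1_close_increment (R : realType) (f g : R -> R) (x y e : R) :
  x <= y ->
  (forall z, x <= z <= y ->
     [/\ derivable f z 1, derivable g z 1 & `|derive1 f z - derive1 g z| <= e]) ->
  `|(f y - f x) - (g y - g x)| <= e * (y - x).
Proof.
move=> xy fg.
have dE z : x <= z <= y -> derivable (f - g) z 1 /\
    derive1 (f - g) z = derive1 f z - derive1 g z.
  move=> /fg[df dg _]; split; first exact: derivableB.
  by rewrite !derive1E -deriveB.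
have le1 : (f - g) y - (f - g) x <= e * (y - x).
  apply: derive1_le_increment => // z zI; have [? ->] := dE z zI; split=> //.
  by have [_ _] := fg z zI; apply: le_trans; exact: ler_norm.
have le2 : (- e) * (y - x) <= (f - g) y - (f - g) x.
  apply: derive1_ge_increment => // z zI; have [? ->] := dE z zI; split=> //.
  by have [_ _] := fg z zI; rewrite ler_norml => /andP[].
move: le1 le2; rewrite -![(f - g) _]/(f _ - g _) => le1 le2.
by rewrite ler_norml; apply/andP; split; lra.
Qed.

Definition increasing_on (R : realType) (K : set R) (f : R -> R) : Prop :=
  forall x y, K x -> K y -> (f x < f y) = (x < y).

Lemma increasing_image_gap (R : realType) (K : set R) (f : R -> R)
    (al be y : R) :
  increasing_on K f -> K al -> K be -> (forall x, al < x < be -> ~ K x) ->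
  (f @` K) y -> y <= f al \/ f be <= y.
Proof.
move=> fM Ka Kb gap [z Kz <-].
have [|alz] := leP z al; first by rewrite leNgt -fM// -leNgt; left.
have [|zbe] := leP be z; first by rewrite leNgt -fM// -leNgt; right.
by have /gap := introT andP (conj alz zbe).
Qed.

Lemma increasing_min_eq (R : realType) (K : set R) (f g : R -> R) (c : R) :
  increasing_on K f -> increasing_on K g -> f @` K = g @` K ->
  K c -> (forall x, K x -> c <= x) -> f c = g c.
Proof.
move=> fM gM fgK Kc cmin.
have [y Ky fcy] : (g @` K) (f c) by rewrite -fgK; exists c.
have [z Kz gcz] : (f @` K) (g c) by rewrite fgK; exists c.
apply/eqP; rewrite eq_le; apply/andP; split.
  by rewrite -gcz leNgt fM// -leNgt cmin.
by rewrite -fcy leNgt gM// -leNgt cmin.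
Qed.

Lemma increasing_max_eq (R : realType) (K : set R) (f g : R -> R) (d : R) :
  increasing_on K f -> increasing_on K g -> f @` K = g @` K ->
  K d -> (forall x, K x -> x <= d) -> f d = g d.
Proof.
move=> fM gM fgK Kd dmax.
have [y Ky fdy] : (g @` K) (f d) by rewrite -fgK; exists d.
have [z Kz gdz] : (f @` K) (g d) by rewrite fgK; exists d.
apply/eqP; rewrite eq_le; apply/andP; split.
  by rewrite -fdy leNgt gM// -leNgt dmax.
by rewrite -gdz leNgt fM// -leNgt dmax.
Qed.

(** The points p and q are the points of agreement nearest to x on either side;
they exist because the agreement set is compact. *)
Lemma maximal_disagreement (R : realType) (K : set R) (c d x : R)
    (f g : R -> R) :
  compact K -> {in K, continuous f} -> {in K, continuous g} ->
  K c -> f c = g c -> K d -> f d = g d -> c <= x <= d -> f x <> g x ->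
  exists p q, [/\ K p /\ f p = g p, K q /\ f q = g q, p < x < q &
    forall y, K y -> p < y < q -> f y <> g y].
Proof.
move=> cK cf cg Kc fgc Kd fgd /andP[cx xd] fgx.
have cA := compact_agreement cK cf cg.
have [||p [[Kp fgp] /= px] pmax] :=
  @compact_has_max R (K `&` [set x | f x = g x] `&` [set y | y <= x]).
- by apply: compact_closedI => //; exact: closed_le.
- by exists c.
have [||q [[Kq fgq] /= qx] qmin] :=
  @compact_has_min R (K `&` [set x | f x = g x] `&` [set y | x <= y]).
- by apply: compact_closedI => //; exact: closed_ge.
- by exists d.
exists p, q; split=> //.
  by rewrite !lt_neqAle px qx !andbT; apply/andP; split;
    apply: contra_notN fgx => /eqP; [move=> <-|move=> ->].
move=> y Ky /andP[py yq] fgy; have [yx|xy] := leP y x.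
  by have := pmax y (conj (conj Ky fgy) yx); rewrite leNgt py.
by have := qmin y (conj (conj Ky fgy) (ltW xy)); rewrite leNgt yq.
Qed.

(** A large gap between two consecutive points of agreement p and q must have
the same image under f and g: otherwise the two images are disjoint gaps of
f(K), and f - g, which vanishes at p, would grow too fast. *)
Lemma eq_on_sparse (R : realType) (K : set R) (c d sigma m : R)
    (f g : R -> R) :
  compact K -> K c -> K d -> (forall x, K x -> c <= x <= d) ->
  0 < sigma -> sigma_sparse sigma K -> 0 < m ->
  (forall x, c <= x <= d -> derivable f x 1 /\ m <= derive1 f x) ->
  (forall x, c <= x <= d -> derivable g x 1 /\ m <= derive1 g x) ->
  (forall x, c <= x <= d -> `|derive1 f x - derive1 g x| <= sigma * m) ->
  f @` K = g @` K ->
  {in K, f =1 g}.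
Proof.
move=> cK Kc Kd Kcd s0 spK m0 fP gP fgP fgK.
have sub x y z : K x -> K y -> x <= z <= y -> c <= z <= d.
  move=> /Kcd/andP[cx _] /Kcd/andP[_ yd] /andP[xz zy].
  by rewrite (le_trans cx xz) (le_trans zy yd).
have expand (h : R -> R) :
    (forall x, c <= x <= d -> derivable h x 1 /\ m <= derive1 h x) ->
    forall x y, K x -> K y -> x <= y -> m * (y - x) <= h y - h x.
  move=> hP x y Kx Ky xy; apply: derive1_ge_increment => // z zI.
  by apply: hP; exact: sub zI.
have mono (h : R -> R) :
    (forall x, c <= x <= d -> derivable h x 1 /\ m <= derive1 h x) ->
    increasing_on K h.
  move=> hP; have incr x y : K x -> K y -> x < y -> h x < h y.
    move=> Kx Ky xy; have := expand h hP x y Kx Ky (ltW xy).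
    have : 0 < m * (y - x) by rewrite mulr_gt0// subr_gt0.
    lra.
  move=> x y Kx Ky; case: (ltrgtP x y) => [xy|yx|->]; last by rewrite ltxx.
    exact: incr.
  by apply/negbTE; rewrite -leNgt ltW// incr.
have fM := mono f fP; have gM := mono g gP.
have cont (h : R -> R) :
    (forall x, c <= x <= d -> derivable h x 1 /\ m <= derive1 h x) ->
    {in K, continuous h}.
  move=> hP x; rewrite inE => /Kcd/hP[dh _].
  exact/differentiable_continuous/derivable1_diffP.
move=> x; rewrite inE => Kx; apply: contrapT => fgx.
have [p [q [[Kp fgp] [Kq fgq] /andP[px xq] pq_disagree]]] :
    exists p q, [/\ K p /\ f p = g p, K q /\ f q = g q, p < x < q &
    forall y, K y -> p < y < q -> f y <> g y].
  apply: (@maximal_disagreement R K c d x) => //;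
    [exact: cont|exact: cont| | |exact: Kcd].
    by apply: increasing_min_eq fM gM fgK Kc _ => y /Kcd/andP[].
  by apply: increasing_max_eq fM gM fgK Kd _ => y /Kcd/andP[].
have [al [be [/complementary_itvoo[ab Ka Kb gap] sub_pq big]]] :=
  spK p q Kp Kq (lt_trans px xq).
have [pa bq] : p <= al /\ be <= q.
  by apply: itvoo_subset => // y /sub_pq[].
(* The inequality is strict because al < be <= q. *)
have close : `|(f al - f p) - (g al - g p)| < sigma * m * (q - p).
  apply: (@le_lt_trans _ _ (sigma * m * (al - p))).
    apply: derive1_close_increment => // z zI; have zcd := sub _ _ _ Kp Ka zI.
    by split; [exact: (fP z _).1|exact: (gP z _).1|exact: fgP].
  by rewrite ltr_pM2l ?mulr_gt0//; lra.
have far : sigma * m * (q - p) <= m * (be - al).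
  by rewrite mulrAC mulrC ler_wpM2l// ltW.
have fE := expand f fP al be Ka Kb (ltW ab).
have gE := expand g gP al be Ka Kb (ltW ab).
have mab : 0 < m * (be - al) by rewrite mulr_gt0// subr_gt0.
move: close; rewrite ltr_norml => /andP[close1 close2].
have fal : (g @` K) (f al) by rewrite -fgK; exists al.
have fbe : (g @` K) (f be) by rewrite -fgK; exists be.
have gal : (f @` K) (g al) by rewrite fgK; exists al.
have gbe : (f @` K) (g be) by rewrite fgK; exists be.
(* If f al < g al, then g al is beyond the gap of f(K) between f al and f be,
   so that g al - f al is at least f be - f al, against [close] and [far]. *)
have fgal : f al = g al.
  have [?|?] := increasing_image_gap fM Ka Kb gap gal;
  have [?|?] := increasing_image_gap gM Ka Kb gap fal; lra.
have fgbe : f be = g be.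
  have [?|?] := increasing_image_gap fM Ka Kb gap gbe;
  have [?|?] := increasing_image_gap gM Ka Kb gap fbe; lra.
(* Agreement at both ends of the gap forces al = p and be = q. *)
have [pal|ap] := ltP p al.
  by apply: (pq_disagree al Ka _ fgal); rewrite pal (lt_le_trans ab).
have [beq|qb] := ltP be q.
  by apply: (pq_disagree be Kb _ fgbe); rewrite beq (le_lt_trans pa).
by apply: (gap x _ Kx); rewrite (le_lt_trans ap)//= (lt_le_trans xq).
Qed.

(** * Countably many codes *)

Lemma positive_lower_bound (R : realType) (c d : R) (h : R -> R) :
  c <= d -> {within `[c, d], continuous h} ->
  (forall x, c <= x <= d -> h x != 0) -> 0 < h c ->
  exists2 q : rat, 0 < q & forall x, c <= x <= d -> ratr q <= h x.
Proof.
move=> cd ch hn0 hc.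
have [x0 x0I hmin] := EVT_min cd ch.
have {x0I}/andP[cx0 x0d] : c <= x0 <= d by rewrite in_itv in x0I.
have : 0 < h x0.
  rewrite ltNge; apply/negP => hx0.
  have ch0 : {within `[c, x0], continuous h}.
    by apply: continuous_subspaceW ch; apply: subset_itvl; rewrite bnd_simp.
  have [|y] := @IVT R h c x0 0 cx0 ch0.
    by rewrite ge_min hx0 orbT le_max (ltW hc).
  rewrite in_itv/= => /andP[cy yx0] /eqP; apply/negP/hn0.
  by rewrite cy (le_trans yx0).
move=> /rat_in_itvoo[q]; rewrite in_itv/= ltr0q => /andP[q0 qh].
by exists q => // x xI; rewrite (le_trans (ltW qh))// hmin// in_itv.
Qed.

Lemma signed_lower_bound (R : realType) (c d : R) (h : R -> R) :
  c <= d -> {within `[c, d], continuous h} ->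
  (forall x, c <= x <= d -> h x != 0) ->
  exists b : bool, exists2 q : rat, 0 < q &
    forall x, c <= x <= d -> ratr q <= (-1) ^+ b * h x.
Proof.
move=> cd ch hn0.
have : h c != 0 by apply: hn0; rewrite lexx.
rewrite neq_lt => /orP[hc|hc]; last first.
  have [q q0 qh] := positive_lower_bound cd ch hn0 hc.
  by exists false, q => // x /qh; rewrite expr0 mul1r.
have [||||q q0 qh] := @positive_lower_bound R c d (- h) => //.
- by move=> x; apply: continuousN; exact: ch.
- by move=> x /hn0; rewrite -[(- h) x]/(- h x) oppr_eq0.
- by rewrite -[(- h) c]/(- h c) oppr_gt0.
by exists true, q => // x /qh; rewrite expr1 mulN1r.
Qed.

(** A form of the separability of the continuous functions on a segment: up to e,
the function h is described by a finite list of rational data (u, v, r), each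
saying that h is within e of r on ]u, v[. Overlapping intervals are used, rather
than a subdivision, because they come directly from a finite subcover. *)
Lemma rational_step_approximation (R : realType) (c d e : R) (h : R -> R) :
  {within `[c, d], continuous h} -> 0 < e ->
  exists s : seq (rat * rat * rat),
    (forall x, c <= x <= d -> exists2 t, t \in s & ratr t.1.1 < x < ratr t.1.2) /\
    (forall t x, t \in s -> c <= x <= d -> ratr t.1.1 < x < ratr t.1.2 ->
       `|h x - ratr t.2| <= e).
Proof.
move=> ch e0.
pose D := [set t : rat * rat * rat | forall x, c <= x <= d ->
  ratr t.1.1 < x < ratr t.1.2 -> `|h x - ratr t.2| <= e].
pose I (t : rat * rat * rat) := `](ratr t.1.1 : R), ratr t.1.2[%classic.
have := @segment_compact R c d; rewrite compact_cover => /(_ _ D I)[||s sD cov].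
- by move=> t _; exact: interval_open.
- move=> x; rewrite /= in_itv/= => xI.
  have /subspace_continuousP/(_ x) := ch; rewrite /= in_itv/= xI => /(_ isT) chx.
  have e2 : 0 < e / 2 by rewrite divr_gt0.
  have : nbhs x [set y | `[c, d]%classic y -> ball (h x) (e / 2) (h y)].
    exact: (chx (ball (h x) (e / 2)) (nbhsx_ballx _ _ e2)).
  move=> /nbhs_ballP[r /= r0 rh].
  have [u] : exists u, ratr u \in `]x - r, x[ by apply: rat_in_itvoo; lra.
  have [v] : exists v, ratr v \in `]x, x + r[ by apply: rat_in_itvoo; lra.
  have [w] : exists w, ratr w \in `]h x - e / 2, h x + e / 2[.
    by apply: rat_in_itvoo; lra.
  rewrite !in_itv/= => /andP[w1 w2] /andP[v1 v2] /andP[u1 u2].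
  exists (u, v, w); last by rewrite /I /= in_itv/= u2 v1.
  move=> y yI /= /andP[uy yv].
  have := rh y; rewrite /ball/= in_itv/= => /(_ _ yI).
  have xy : `|x - y| < r by rewrite ltr_norml; apply/andP; split; lra.
  move=> /(_ xy); rewrite ltr_norml => /andP[h1 h2].
  by rewrite ler_norml; apply/andP; split; lra.
exists (finmap.enum_fset s); split.
  move=> x xI; have /cov[t /= ts It] : `[c, d]%classic x by rewrite /= in_itv.
  by exists t => //; move: It; rewrite /I /= in_itv.
by move=> t x /sD; rewrite inE; apply.
Qed.

(** The precision depends on the lower bound q, in such a way that two functions
with the same code have derivatives within sigma q of each other, which is what
rigidity asks for. *)
Definition encodes (R : realType) (sigma c d : R)
    (k : bool * rat * seq (rat * rat * rat)) (f : R -> R) : Prop :=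
  let: (b, q, s) := k in
  [/\ 0 < q,
    forall x, c <= x <= d ->
      derivable f x 1 /\ ratr q <= (-1) ^+ b * derive1 f x,
    forall x, c <= x <= d -> exists2 t, t \in s & ratr t.1.1 < x < ratr t.1.2 &
    forall t x, t \in s -> c <= x <= d -> ratr t.1.1 < x < ratr t.1.2 ->
      `|derive1 f x - ratr t.2| <= sigma * ratr q / 2].

Definition C1_immersion (R : realType) (c d : R) (f : R -> R) : Prop :=
  (forall x, c <= x <= d -> derivable f x 1 /\ derive1 f x != 0) /\
  {within `[c, d], continuous (derive1 f)}.

Lemma encodes_exists (R : realType) (sigma c d : R) (f : R -> R) :
  0 < sigma -> c <= d -> C1_immersion c d f -> exists k, encodes sigma c d k f.
Proof.
move=> s0 cd [fP cf].
have [b [q q0 qf]] := signed_lower_bound cd cf (fun x xI => (fP x xI).2).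
have e0 : 0 < sigma * ratr q / 2 by rewrite divr_gt0// mulr_gt0// ltr0q.
have [s [cov appr]] := rational_step_approximation cf e0.
exists (b, q, s); split=> // x xI; split; [exact: (fP x xI).1|exact: qf].
Qed.

(** For decreasing functions rigidity is applied to the opposites, whose common
image is -f(K): this is why rigidity allows an image other than K. *)
Lemma encodes_inj (R : realType) (K : set R) (sigma c d : R) k (f g : R -> R) :
  compact K -> K c -> K d -> (forall x, K x -> c <= x <= d) ->
  0 < sigma -> sigma_sparse sigma K ->
  encodes sigma c d k f -> encodes sigma c d k g ->
  f @` K = g @` K -> {in K, f =1 g}.
Proof.
move=> cK Kc Kd Kcd s0 spK; move: k => [[b q] s].
move=> [q0 fP cov fs] [_ gP _ gs] fgK.
have close x : c <= x <= d -> `|derive1 f x - derive1 g x| <= sigma * ratr q.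
  move=> xI; have [t ts tx] := cov x xI.
  have := fs t x ts xI tx; have := gs t x ts xI tx.
  rewrite !ler_norml => /andP[h1 h2] /andP[h3 h4]; apply/andP; split; lra.
have q0R : 0 < ratr q :> R by rewrite ltr0q.
move: b fP gP => [] fP gP; last first.
  by apply: (eq_on_sparse cK Kc Kd Kcd s0 spK q0R) => // x xI;
    [have [] := fP x xI|have [] := gP x xI]; rewrite expr0 mul1r.
have negP (h : R -> R) : (forall x, c <= x <= d ->
      derivable h x 1 /\ ratr q <= (-1) ^+ true * derive1 h x) ->
    forall x, c <= x <= d -> derivable (- h) x 1 /\ ratr q <= derive1 (- h) x.
  move=> hP x /hP[dh]; rewrite expr1 mulN1r => qh; split; first exact: derivableN.
  by rewrite derive1E deriveN// -derive1E.
have negK : (- f) @` K = (- g) @` K.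
  have negK (h : R -> R) : (- h) @` K = -%R @` (h @` K) by rewrite image_comp.
  by rewrite !negK fgK.
move=> x Kx; apply: oppr_inj.
apply: (eq_on_sparse cK Kc Kd Kcd s0 spK q0R (negP f fP) (negP g gP) _ negK Kx).
move=> y yI; have [df _] := fP y yI; have [dg _] := gP y yI.
rewrite !derive1E !deriveN// -!derive1E -opprD normrN; exact: close.
Qed.

Lemma countable_by_codes (X : countType) (T : Type) (A : set T)
    (P : X -> T -> Prop) :
  (forall x, A x -> exists k, P k x) ->
  (forall k x y, A x -> A y -> P k x -> P k y -> x = y) ->
  countable A.
Proof.
move=> Pex Pinj.
have /choice[code codeP] : forall x, exists n : nat,
    A x -> exists2 k, n = choice.pickle k & P k x.
  move=> x; have [/Pex[k Pkx]|nAx] := pselect (A x); last by exists 0%N.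
  by exists (choice.pickle k) => _; exists k.
apply/countable_injP; exists code => x y; rewrite !inE => Ax Ay xy.
have [k kx Pkx] := codeP x Ax; have [l ly Ply] := codeP y Ay.
have kl : k = l by apply: (pcan_inj choice.pickleK); rewrite -kx -ly.
by apply: (Pinj k) => //; rewrite kl.
Qed.

Lemma derive1_neq0_of_inverse (R : realType) (f g : R -> R) (x : R) :
  derivable f x 1 -> derivable g (f x) 1 -> (\near x, g (f x) = x) ->
  derive1 f x != 0.
Proof.
move=> df dg gf; apply/eqP => f0.
have := derive1_comp df dg; rewrite f0 mulr0 derive1E.
rewrite (near_eq_derive _ (_ : \near x, (g \o f) x = id x)) ?derive_id//.
by move/eqP; rewrite oner_eq0.
Qed.

Lemma countable_line_restrictions (R : realType) (C : set R) :
  cantor_set C -> sparse C -> countable (restrictions (@line_C1 R) C).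
Proof.
move=> [C0 cC _ _] [sigma s0 spC].
have [c Cc cmin] := compact_has_min cC C0.
have [d Cd dmax] := compact_has_max cC C0.
have Ccd x : C x -> c <= x <= d by move=> Cx; rewrite cmin//= dmax.
apply: (@countable_by_codes _ _ _ (fun k g => exists2 f : R -> R,
  encodes sigma c d k f & f @` C = C /\ forall x : C, val (g x) = f (val x))).
- move=> g [f [[[df cf] [finv [[dfinv _] fK _]]] fC gf]].
  have [|k kf] := @encodes_exists R sigma c d f s0 (cmin _ Cd).
    split=> [x _|]; last by apply: continuous_subspaceW cf.
    split; first exact: df.
    apply: (derive1_neq0_of_inverse (df x I) (dfinv (f x) I)).
    by near do exact: fK.
  by exists k, f.
- move=> k g1 g2 _ _ [f1 kf1 [f1C gf1]] [f2 kf2 [f2C gf2]].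
  have f12 := encodes_inj cC Cc Cd Ccd s0 spC kf1 kf2 (etrans f1C (esym f2C)).
  apply: funext => x; apply: val_inj; rewrite gf1 gf2; apply: f12.
  exact: valP.
Unshelve. all: by end_near. Qed.

(** * The circle *)

Lemma circle_pi_continuous (R : realType) : continuous (@circle_pi R).
Proof. exact: pi_continuous. Qed.

Lemma circle_pi_inj (R : realType) (a : R) (s t : R) :
  a <= s < a + 1 -> a <= t < a + 1 -> circle_pi s = circle_pi t -> s = t.
Proof. by move=> sI tI st; rewrite -(circle_piK sI) st circle_piK. Qed.

(** The saturation of V is the union of its integer translates. *)
Lemma circle_pi_open (R : realType) (V : set R) :
  open V -> open (@circle_pi R @` V).
Proof.
move=> oV.
have E : @circle_pi R @^-1` (@circle_pi R @` V) =
    \bigcup_(n : int) ((fun t => t + n%:~R) @^-1` V).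
  apply/seteqP; split=> [t [v Vv /circle_piP/intrP[n vtn]]|t [n _ /= Vtn]].
    by exists n => //=; rewrite -vtn addrC subrK.
  by exists (t + n%:~R) => //; apply/circle_piP; rewrite addrC addKr intr_int.
suff : open (@circle_pi R @^-1` (@circle_pi R @` V)) by [].
rewrite E; apply: bigcup_open => n _; apply: open_comp => // t _.
by apply: cvgD; [exact: cvg_id|exact: cvg_cst].
Qed.

Lemma chart_itvoo (R : realType) (a : R) (p : circle R) :
  p <> circle_pi a -> a < chart a p < a + 1.
Proof.
move=> pa; have /andP[ap pa1] := chart_itv a p; rewrite pa1 andbT.
rewrite lt_neqAle ap andbT; apply: contra_notN pa => /eqP apE.
by rewrite -[LHS](chartK a) -apE.
Qed.

Lemma chart_continuous (R : realType) (a : R) (p : circle R) :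
  p <> circle_pi a -> {for p, continuous (chart a)}.
Proof.
move=> /chart_itvoo pI W; rewrite nbhsE => -[V [oV Vp] VW].
pose V' := V `&` `]a, a + 1[.
have oV' : open V' by apply: openI => //; exact: interval_open.
apply: (@filterS _ _ _ (@circle_pi R @` V')).
  move=> _ [t [Vt /=]] + <-; rewrite in_itv/= => /andP[at1 ta1].
  by rewrite /= circle_piK; [exact: VW|rewrite ltW].
apply: open_nbhs_nbhs; split; first exact: circle_pi_open.
by exists (chart a p); [split=> //=; rewrite in_itv|exact: chartK].
Qed.

Lemma open_has_rat (R : realType) (V : set R) :
  open V -> V !=set0 -> exists q : rat, V (ratr q).
Proof.
move=> oV [x Vx]; have /nbhs_ballP[r /= r0 rV] := open_nbhs_nbhs (conj oV Vx).
have [q] : exists q, ratr q \in `]x, x + r[ by apply: rat_in_itvoo; rewrite ltrDl.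
rewrite in_itv/= => /andP[q1 q2]; exists q; apply: rV.
by rewrite /ball/= ltr_norml; apply/andP; split; lra.
Qed.

(** The preimage under g of the arc complementary to [c, d] is a nonempty open
subset of the circle, and its inverse image in the reals contains a rational. *)
Lemma rational_cut (R : realType) (c d : R) (f g : circle R -> circle R) :
  d < c + 1 -> cancel f g -> cancel g f -> continuous g ->
  exists b : rat, forall t, c <= t <= d -> f (circle_pi t) <> circle_pi (ratr b).
Proof.
move=> dc fK gK cg.
have oW : open ((g \o @circle_pi R) @^-1` (@circle_pi R @` `]d, c + 1[)).
  apply: open_comp; last by apply: circle_pi_open; exact: interval_open.
  by move=> t _; apply: continuous_comp; [exact: circle_pi_continuous|exact: cg].
have [|b [v /=]] := open_has_rat oW.
  pose v := (d + (c + 1)) / 2; exists (chart 0 (f (circle_pi v))).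
  exists v; first by rewrite /= in_itv/= /v; apply/andP; split; lra.
  by rewrite /= chartK fK.
rewrite in_itv/= => /andP[dv vc] vb; exists b => t /andP[ct td] ftb.
have : t = v.
  by apply: (@circle_pi_inj _ c); [apply/andP; split; lra..|rewrite vb -ftb fK].
lra.
Qed.

(** The derivative does not vanish because the expression of g in the charts at b
and a is, near the point considered, a derivable left inverse. *)
Lemma chart_C1_immersion (R : realType) (a b c d : R)
    (f g : circle R -> circle R) :
  circle_C1 f -> circle_C1 g -> cancel f g -> a < c -> d < a + 1 ->
  (forall t, c <= t <= d -> f (circle_pi t) <> circle_pi b) ->
  C1_immersion c d (chart b \o f \o @circle_pi R).
Proof.
move=> [_ fC1] [_ gC1] fK ac da fb.
have [df cf] := fC1 a b; have [dg _] := gC1 b a.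
have inU t : c <= t <= d -> a < t < a + 1 /\ f (circle_pi t) <> circle_pi b.
  move=> tI; split; last exact: fb.
  by case/andP: tI => ct td; apply/andP; split; lra.
split; last first.
  by apply: continuous_subspaceW cf => t; rewrite /= in_itv/= => /inU.
move=> t tI; have [tU ftb] := inU t tI; split; first by apply: df; split.
apply: (@derive1_neq0_of_inverse _ _ (chart a \o g \o @circle_pi R)).
- by apply: df; split.
- apply: dg; split; first exact: chart_itvoo.
  rewrite /= chartK fK => ta; have /andP[at1 ta1] := tU.
  suff : t = a by lra.
  by apply: (@circle_pi_inj _ a) => //; apply/andP; split; lra.
- have : nbhs t `]a, a + 1[%classic.
    by apply: open_nbhs_nbhs; split; [exact: interval_open|rewrite /= in_itv].
  apply: filterS => s; rewrite /= in_itv/= => /andP[as1 sa1].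
  by rewrite chartK fK circle_piK// sa1 ltW.
Qed.

(** The rational cut of the target is part of the code: it fixes the common image
of K in the chart, and the chart is injective. *)
Lemma countable_circle_restrictions (R : realType) (C : set (circle R)) :
  cantor_set C -> circle_sparse C -> countable (restrictions (@circle_C1 R) C).
Proof.
move=> [C0 cC _ _] [a nCa [sigma s0 spK]].
have Ca p : C p -> p <> circle_pi a by move=> Cp pa; apply: nCa; rewrite -pa.
pose K := chart a @` C.
have cK : compact K.
  apply: continuous_compact => //; apply: continuous_in_subspaceT => p.
  by rewrite inE => Cp; apply: chart_continuous; exact: Ca.
have K0 : K !=set0 by exact: image_nonempty.
have [c Kc cmin] := compact_has_min cK K0.
have [d Kd dmax] := compact_has_max cK K0.
have KI x : K x -> c <= x <= d by move=> Kx; rewrite cmin//= dmax.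
have Koo x : K x -> a < x < a + 1 by move=> [p /Ca/chart_itvoo pI <-].
have /andP[ac _] := Koo c Kc; have /andP[_ da] := Koo d Kd.
apply: (@countable_by_codes _ _ _
  (fun (k : rat * (bool * rat * seq (rat * rat * rat))) h =>
    exists2 F : R -> R, encodes sigma c d k.2 F &
      F @` K = chart (ratr k.1) @` C /\
      forall x : C, chart (ratr k.1) (val (h x)) = F (chart a (val x)))).
- move=> h [f [[f1 [g [g1 fK gK]]] fC hf]].
  have [|b fb] := @rational_cut R c d f g _ fK gK g1.1; first lra.
  pose F : R -> R := chart (ratr b) \o f \o @circle_pi R.
  have [|k kF] := @encodes_exists R sigma c d F s0 (cmin _ Kd).
    exact: (@chart_C1_immersion R a (ratr b) c d f g).
  exists (b, k), F => //; split.
    rewrite -[in RHS]fC !image_comp; apply: eq_imagel => p _.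
    by rewrite /F /= chartK.
  by move=> x; rewrite /F /= chartK hf.
- move=> [b k] h1 h2 _ _ [F1 kF1 [F1K hF1]] [F2 kF2 [F2K hF2]].
  have F12 := encodes_inj cK Kc Kd KI s0 spK kF1 kF2 (etrans F1K (esym F2K)).
  apply: funext => x; apply: val_inj.
  apply: (can_inj (@chartK R (ratr b))); rewrite hF1 hF2; apply: F12.
  by rewrite inE; exists (val x) => //; exact: set_valP.
Qed.

Theorem theorem2 (R : realType) :
  (forall C : set R, cantor_set C -> sparse C ->
     countable (restrictions (@line_C1 R) C)) /\
  (forall C : set (circle R), cantor_set C -> circle_sparse C ->
     countable (restrictions (@circle_C1 R) C)).
Proof.
split=> C; first exact: countable_line_restrictions.
exact: countable_circle_restrictions.
Qed.
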